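(* For each fixed integer $d>1$ there exists a constant $c_d>0$ such that the following holds. Let $r=r(n)>0$ satisfy $r^{3d-1} > c_d \frac{\log n}{n}$. Then asymptotically almost surely (i.e., with probability tending to $1$ as $n\to\infty$) the random geometric graph $\mathcal{G}_d(n,r)$ has cop number $c(\mathcal{G}_d(n,r))=1$.
   Context: The game of Cops and Robbers is played on a finite simple undirected graph $G$ by $k\ge 1$ cops and one robber. The cops first occupy any $k$ vertices (several cops may share a vertex); then the robber chooses a vertex; then the cops and the robber move in alternate rounds, where in a move each player either stays at its current vertex or moves along an edge to an adjacent vertex. Both sides always know all current positions. The cops win if at some point a cop occupies the same vertex as the robber; otherwise the robber wins. The cop number $c(G)$ is the minimum $k$ such that $k$ cops have a winning strategy on $G$. The random geometric graph $\mathcal{G}_d(n,r)$ has vertex set $\{1,\dots,n\}$; the $n$ vertices are assigned points chosen independently and uniformly at random from $[0,1]^d$, and two vertices are adjacent if and only if the Euclidean distance between their points is at most $r$. Here $r=r(n)$ may depend on $n$, and asymptotics are as $n\to\infty$. *)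

(* Defs.v *)
From HB Require Import structures.
From mathcomp Require Import all_boot all_order all_algebra.
From mathcomp Require Import all_classical all_reals all_analysis.
Set Implicit Arguments.
Unset Strict Implicit.
Unset Printing Implicit Defensive.
Import Order.TTheory GRing.Theory Num.Theory.
Local Open Scope ring_scope.
Local Open Scope classical_set_scope.

Section CopsRobbers.
Variables (T : finType) (adj : rel T).

Definition pmove (x y : T) : bool := (y == x) || adj x y.

Definition cmove (k : nat) (c c' : {ffun 'I_k -> T}) : bool :=
  [forall i, pmove (c i) (c' i)].

Definition caught (k : nat) (c : {ffun 'I_k -> T}) (x : T) : bool :=
  [exists i, c i == x].

(* cops_force k t c x : position with cops at c, robber at x, cops to move;
   the cops can force capture within t further rounds, whatever the robber
   does (perfect information; the choice of each cop move may depend on the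
   whole history, which is implicit in the nesting of the quantifiers). *)
Fixpoint cops_force (k : nat) (t : nat) (c : {ffun 'I_k -> T}) (x : T) : Prop :=
  match t with
  | 0 => caught c x
  | t'.+1 => caught c x \/
      exists c' : {ffun 'I_k -> T}, cmove c c' /\
        (caught c' x \/ forall x' : T, pmove x x' -> cops_force t' c' x')
  end.

Definition cops_win (k : nat) : Prop :=
  exists c0 : {ffun 'I_k -> T}, forall x0 : T, exists t : nat, cops_force t c0 x0.

(* cop number c(G) = min { k >= 1 | k cops win }; hence c(G) = 1 iff
   a single cop wins. *)
Definition cop_number_is_one : Prop := cops_win 1.
End CopsRobbers.

Section RGG.
Variable R : realType.

(* Law of N i.i.d. uniform points of [0,1], as a measure on sequences of
   reals of length N, built by iterating the product-measure construction
   of the library (m1 \x m2)(A) = \int[m1]_x m2 (xsection A x):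
   unif_cube 0 E = 1 if [::] \in E else 0,
   unif_cube (N+1) E = \int_{[0,1]} unif_cube N {s | x :: s \in E} dx. *)
Fixpoint unif_cube (N : nat) (E : set (seq R)) : \bar R :=
  match N with
  | 0 => ((asbool (E [::]))%:R)%:E
  | N'.+1 => (\int[@lebesgue_measure R]_(x in `[0%R, 1%R]%classic)
               unif_cube N' [set s | E (x :: s)])%E
  end.

(* position of vertex i (of n vertices) in [0,1]^d, read from the
   sequence s of n*d i.i.d. uniform coordinates *)
Definition rgg_point (d n : nat) (s : seq R) (i : 'I_n) : 'rV[R]_d :=
  \row_(k < d) nth 0 s (i * d + k)%N.

Definition euclid_dist (d : nat) (p q : 'rV[R]_d) : R :=
  Num.sqrt (\sum_(k < d) (p ord0 k - q ord0 k) ^+ 2).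

Definition rgg_adj (d n : nat) (r : R) (s : seq R) : rel 'I_n :=
  fun i j => (i != j) && (euclid_dist (@rgg_point d n s i) (@rgg_point d n s j) <= r).

Definition rgg_prob (d n : nat) (r : R) (P : rel 'I_n -> Prop) : \bar R :=
  unif_cube (n * d) [set s | P (@rgg_adj d n r s)].
End RGG.

(* Main.v *)
(* Order the vertices by the distance of their points to the corner 0 of the
   cube.  The points within r/2 of 0 form a clique.  If x is further away, a
   point y = (1 - s) x + e with s of order r^2 / |x|^2 and |e| <= s r / 4 is
   closer to 0 than x and within r of every z with |z| <= |x| and |z - x| <= r,
   since |z| <= |x| forces 2 x.(x - z) >= |z - x|^2.  So when all these regions
   contain points the graph is dismantlable, and one cop wins by chasing the
   images of the robber under the successive retractions.  Each region, of
   length r^2 and width r^3, contains K ~ 1/r cells of a grid of mesh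
   h ~ r^3, hence n points all miss it with probability at most
   (1 - K h^d)^n <= exp(- kappa n r^(3d-1)) <= n^-3, while a union bound over
   the grid cells containing x involves h^-d = O(n^2) regions. *)
Require Import Defs.
From HB Require Import structures.
From mathcomp Require Import all_boot all_order all_algebra.
From mathcomp Require Import all_classical all_reals all_analysis.
From mathcomp Require Import measurable_realfun ring lra.
Import Order.TTheory GRing.Theory Num.Theory.
Local Open Scope ring_scope.
Local Open Scope classical_set_scope.

(** * Cop-win graphs *)

Section Dismantling.
Variables (T : finType) (e : rel T).
Hypotheses (e_refl : reflexive e) (e_sym : symmetric e).

(** The game for one cop with the robber confined to [S] while the cop roams over all of [T]. A
    single relation [e], meant to be the reflexive closure of adjacency, serves both players. *)
Fixpoint capturable (S : {set T}) (t : nat) (c x : T) : Prop :=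
  match t with
  | 0 => c = x
  | t'.+1 => c = x \/
      exists2 c', e c c' & c' = x \/
        forall x', x' \in S -> e x x' -> capturable S t' c' x'
  end.

(* The cop chases the image of the robber under the retraction u |-> w; once
   the image is caught, either the robber is, or the robber sits on u and the
   cop on w, from where every vertex reachable by the robber is reachable. *)
Lemma capturable_retract (S : {set T}) (u w : T) :
  u \in S -> w \in S :\ u -> (forall z, z \in S -> e u z -> e w z) ->
  forall t c x, x \in S ->
    capturable (S :\ u) t c (if x == u then w else x) -> capturable S t.+1 c x.
Proof.
move=> uS wS dom.
have wu : e w u by exact: dom.
have step c x : c = (if x == u then w else x) -> c = x \/ exists2 c', e c c' & c' = x.
  move=> ->; case: eqVneq => [->|_]; last by left.
  by right; exists u.
have caught_step t c x : c = (if x == u then w else x) -> capturable S t.+1 c x.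
  by move=> /step[|[c' cc' c'x]] /=; [left|right; exists c' => //; left].
elim=> [|t IH] c x xS; first exact: caught_step.
case=> [|[c' cc' H]]; first exact: caught_step.
right; exists c' => //; case: H => [c'x|H].
  have [c'x'|[v c'v vx]] := step _ _ c'x; first by left.
  case: (eqVneq x u) => xu; last first.
    by move: c'x; rewrite (negbTE xu); left.
  right=> x' x'S xx'; move: c'x; rewrite xu eqxx => ->.
  by right; exists x'; [apply: dom; rewrite -?xu|left].
right=> x' x'S xx'; apply: IH => //; apply: H.
  by case: (eqVneq x' u) => // x'u; rewrite in_setD1 x'u.
case: (eqVneq x u) xx' => [->|xu]; case: (eqVneq x' u) => [->|x'u] // xx'.
- exact: dom.
- by rewrite e_sym; apply: dom => //; rewrite e_sym.
Qed.

Variables (R : realType) (phi : T -> R) (theta : R).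
Hypothesis core_clique : forall x y, phi x <= theta -> phi y <= theta -> e x y.
Hypothesis dominated : forall x, theta < phi x ->
  exists2 y, phi y < phi x & forall z, phi z <= phi x -> e x z -> e y z.

(** Induction on the size of [S], removing a vertex [u] of maximal [phi]. Its dominating vertex has
    smaller [phi], hence lies in the lower set [S], and [S] without [u] is again a lower set because
    [u] was maximal. Ties do no harm since the closure condition is strict. *)
Lemma capturable_lower_set (m : nat) (S : {set T}) :
  (#|S| <= m)%N -> S != finset.set0 ->
  (forall z z', z \in S -> phi z' < phi z -> z' \in S) ->
  exists c0, forall x, x \in S -> exists t, capturable S t c0 x.
Proof.
elim: m S => [|m IH] S Sm S0 Sdown.
  by move: Sm; rewrite leqn0 cards_eq0 (negbTE S0).
have [x0 x0S] := set0Pn _ S0.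
case: (@arg_maxP _ _ _ x0 (fun z => z \in S) phi x0S) => u uS umax.
(* If even the maximum lies in the core, [S] is a clique and a cop on [u] captures in one move. *)
have [u_core|/dominated[w wu dom]] := leP (phi u) theta.
  exists u => x xS; exists 1%N; right; exists x; last by left.
  by apply: core_clique => //; apply: le_trans u_core; exact: umax.
have wS : w \in S :\ u.
  by rewrite in_setD1 (Sdown u) // andbT; apply: contraTneq wu => ->; rewrite ltxx.
case: (IH (S :\ u)).
- by move: Sm; rewrite (cardsD1 u S) uS.
- by apply/set0Pn; exists w.
- move=> z z'; rewrite !in_setD1 => /andP[_ zS] z'z; rewrite (Sdown _ _ zS z'z) andbT.
  by apply: contraTneq z'z => ->; rewrite -leNgt; exact: umax.
move=> c0 c0win; exists c0 => x xS.
have [|t ct] := c0win (if x == u then w else x).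
  by case: eqVneq => // xu; rewrite in_setD1 xu.
exists t.+1; apply: (capturable_retract _ _ _ uS wS) ct => // z zS.
by apply: dom; exact: umax.
Qed.
End Dismantling.

Lemma capturable_cops_force (T : finType) (adj : rel T) (t : nat) (c x : T) :
  capturable T (pmove adj) [set: T]%SET t c x ->
  cops_force adj t ([ffun=> c] : {ffun 'I_1 -> T}) x.
Proof.
have caughtP (c1 : T) : caught ([ffun=> c1] : {ffun 'I_1 -> T}) c1.
  by apply/existsP; exists ord0; rewrite ffunE.
elim: t c x => [|t IH] c x; first by move=> /= ->.
case=> [->|[c' cc' H]]; first by left.
right; exists [ffun=> c']; split.
  by apply/forallP => i; rewrite !ffunE.
case: H => [->|H]; [by left|right=> x' xx'].
by apply: IH; apply: H => //; rewrite inE.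
Qed.

Lemma cop_win_of_domination (T : finType) (adj : rel T) (R : realType)
    (phi : T -> R) (theta : R) :
  (0 < #|T|)%N -> symmetric adj ->
  (forall x y, phi x <= theta -> phi y <= theta -> pmove adj x y) ->
  (forall x, theta < phi x -> exists2 y, phi y < phi x &
     forall z, phi z <= phi x -> pmove adj x z -> pmove adj y z) ->
  cop_number_is_one adj.
Proof.
move=> T0 adj_sym core dom.
have move_sym : symmetric (pmove adj).
  by move=> x y; rewrite /pmove eq_sym adj_sym.
have move_refl : reflexive (pmove adj) by move=> x; rewrite /pmove eqxx.
have T0' : [set: T]%SET != finset.set0 by rewrite -card_gt0 cardsT.
have Tdown (z z' : T) : z \in [set: T]%SET -> phi z' < phi z -> z' \in [set: T]%SET.
  by rewrite inE.
have [c0 c0win] := capturable_lower_set T _ move_refl move_sym R phi theta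
    core dom #|T| [set: T]%SET (max_card _) T0' Tdown.
exists [ffun=> c0] => x; have [|t ct] := c0win x; first by rewrite inE.
by exists t; exact: capturable_cops_force.
Qed.

(** * Lower bounds for [unif_cube] by counting grid cells *)

Section UnifCube.
Variable R : realType.
Local Notation mu := (@lebesgue_measure R).

(* The integrands are not assumed measurable: the library integral of a
   nonnegative function is a supremum over simple functions below it. *)
Lemma ge0_le_integral_nonmeas d (T : measurableType d)
    (m : {measure set T -> \bar R}) (D : set T) (f g : T -> \bar R) :
  (forall x, D x -> (0 <= f x)%E) -> (forall x, D x -> (f x <= g x)%E) ->
  (\int[m]_(x in D) f x <= \int[m]_(x in D) g x)%E.
Proof.
move=> f0 fg; rewrite !ge0_integralE//; last first.
  by move=> x Dx; apply: le_trans (fg _ Dx); exact: f0.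
apply: ereal_sup_le => _ [h hf <-]; exists h => // x.
apply: le_trans (hf x) _; rewrite /patch; case: ifPn => //.
by rewrite inE; exact: fg.
Qed.

Lemma unif_cube_ge0_le1 N (E : set (seq R)) :
  (0 <= unif_cube N E <= 1)%E.
Proof.
elim: N E => [|N IH] E /=.
  by rewrite !lee_fin ler0n /= lern1 leq_b1.
apply/andP; split; first by apply: integral_ge0 => x _; case/andP: (IH [set s | E (x :: s)]).
have : (\int[mu]_(x in `[0%R, 1%R]%classic) unif_cube N [set s | E (x :: s)] <=
        \int[mu]_(x in `[0%R, 1%R]%classic) cst 1 x)%E.
  by apply: ge0_le_integral_nonmeas => x _; case/andP: (IH [set s | E (x :: s)]).
move/le_trans; apply; rewrite integral_cst//.
rewrite /= lebesgue_measure_itv /=.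
by rewrite lte_fin ltr01 oppr0 adde0 mul1e.
Qed.

(** Half-open, so that distinct cells are disjoint; only the null point 1 of the unit interval is
    left uncovered. *)
Definition cell (M m : nat) : set R := `[m%:R / M%:R, m.+1%:R / M%:R[.

Lemma cell_unit M (m : 'I_M) x : cell M m x -> 0 <= x < 1.
Proof.
rewrite /cell /= in_itv /= => /andP[mx xm].
have M0 : 0 < M%:R :> R by rewrite ltr0n; case: M m {mx xm} => [[]|].
apply/andP; split; first by apply: le_trans mx; rewrite divr_ge0.
by apply: lt_le_trans xm _; rewrite ler_pdivrMr// mul1r ler_nat.
Qed.

Lemma cell_inj M (m m' : nat) x : cell M m x -> cell M m' x -> m = m'.
Proof.
case: M => [|M].
  (* For a mesh count of 0 division yields 0, and the cell is empty. *)
  by rewrite /cell /= !in_itv /= !invr0 !mulr0 => /andP[/le_lt_trans h /h]; rewrite ltxx.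
rewrite /cell /= !in_itv /= !ler_pdivrMr ?ltr_pdivlMr// ?ltr0n//.
move=> /andP[a b] /andP[a' b'].
have := le_lt_trans a b'; have := le_lt_trans a' b.
by rewrite !ltr_nat !ltnS => h1 h2; apply/eqP; rewrite eqn_leq h1 h2.
Qed.

(** The step function with value [a m] on cell [m] lies below [f] and is measurable; each cell has
    measure 1/M, so its integral is the average of the [a m]. *)
Lemma integral_ge_cells M (f : R -> \bar R) (a : 'I_M -> R) :
  (0 < M)%N -> (forall x, (0 <= f x)%E) -> (forall m, 0 <= a m) ->
  (forall (m : 'I_M) x, cell M m x -> ((a m)%:E <= f x)%E) ->
  (((\sum_(m < M) a m) / M%:R)%:E <= \int[mu]_(x in `[0%R, 1%R]%classic) f x)%E.
Proof.
move=> M0 f0 a0 af.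
have M0' : 0 < M%:R :> R by rewrite ltr0n.
have mcell m : measurable (cell M m) by exact: measurable_itv.
have mI : measurable (`[0%R, 1%R]%classic : set R) by exact: measurable_itv.
pose g (m : 'I_M) (x : R) : \bar R := ((a m)%:E * (\1_(cell M m) x)%:E)%E.
have mg m : measurable_fun (`[0%R, 1%R]%classic : set R) (g m).
  by apply: measurable_funeM; apply/measurable_EFinP; exact: measurable_indic.
suff -> : ((\sum_(m < M) a m) / M%:R)%:E =
    (\int[mu]_(x in `[0%R, 1%R]%classic) \sum_(m < M) g m x)%E.
  apply: ge0_le_integral_nonmeas => x xI.
    by apply: sume_ge0 => m _; rewrite /g -EFinM lee_fin mulr_ge0.
  have [[m cmx]|nocell] := pselect (exists m : 'I_M, cell M m x); last first.
    rewrite big1// => m _; rewrite /g indicE memNset ?mulr0 ?mule0// => cmx.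
    by apply: nocell; exists m.
  rewrite (bigD1 m)//= big1 ?adde0; last first.
    move=> m' m'm; rewrite /g indicE memNset ?mule0// => cm'x.
    by move/eqP: m'm; apply; apply/val_inj; exact: cell_inj cm'x cmx.
  by rewrite /g indicE mem_set// mule1; exact: af.
rewrite ge0_integral_sum//; last first.
  by move=> m x _; rewrite /g -EFinM lee_fin mulr_ge0.
rewrite mulr_suml -sumEFin; apply: eq_bigr => m _.
have mi : measurable_fun (`[0%R, 1%R]%classic : set R)
    (EFin \o (\1_(cell M m) : R -> R)).
  by apply/measurable_EFinP; exact: measurable_indic.
have cI : cell M m `&` `[0%R, 1%R]%classic = cell M m.
  by apply: setIidl => x /cell_unit /andP[x0 x1] /=; rewrite in_itv /= x0 ltW.
have mucI : mu (cell M m `&` `[0%R, 1%R]%classic) = (M%:R^-1)%:E.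
  rewrite cI /cell lebesgue_measure_itv /= lte_fin ltr_pM2r ?invr_gt0// ltr_nat.
  by rewrite ltnSn -EFinB -mulrBl -natrB// subSnn mul1r.
have -> : (\int[mu]_(x in `[0%R, 1%R]%classic) g m x =
    (a m)%:E * mu (cell M m `&` `[0%R, 1%R]%classic))%E.
  rewrite -(integral_indic mu mI (mcell m)).
  apply: (@ge0_integralZl_EFin _ _ _ mu _ mI (EFin \o \1_(cell M m)) _ mi _ (a0 m)).
  by move=> x _; rewrite lee_fin.
by rewrite EFinM; congr (_ * _)%E; exact: esym mucI.
Qed.

Definition in_cells M N (t : N.-tuple 'I_M) (s : seq R) :=
  size s = N /\ forall i : 'I_N, cell M (tnth t i) (nth 0 s i).

Lemma big_tuple_cons (V : nmodType) (A : finType) N (F : N.+1.-tuple A -> V) :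
  \sum_(t : N.+1.-tuple A) F t = \sum_a \sum_(t : N.-tuple A) F (cons_tuple a t).
Proof.
rewrite pair_bigA /=.
rewrite (reindex (fun p : A * N.-tuple A => cons_tuple p.1 p.2))//=.
exists (fun t : N.+1.-tuple A => (thead t, behead_tuple t)) => [[a t] _|t _] /=.
  by congr pair; apply/val_inj.
by rewrite [RHS]tuple_eta; apply/val_inj.
Qed.

(** The boxes indexed by [P] are disjoint, lie in [E] and have volume M^-N each. By induction on
    [N]: when the first coordinate is in cell [m], the tuples of [P] starting with [m] bound the
    inner integral, and these counts add up to the size of [P]. *)
Lemma unif_cube_ge_cells M N (E : set (seq R)) (P : pred (N.-tuple 'I_M)) :
  (0 < M)%N -> (forall t s, P t -> in_cells M N t s -> E s) ->
  ((#|P|%:R / M%:R ^+ N)%:E <= unif_cube N E)%E.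
Proof.
move=> M0; elim: N E P => [|N IH] E P PE /=.
  rewrite expr0 divr1 lee_fin ler_nat.
  apply: (@leq_trans (P [tuple] : nat)).
    rewrite -sum1_card big_mkcond (bigD1 [tuple])//= big1 ?addn0; last first.
      by move=> t; rewrite tuple0.
    by case: ifP => //; rewrite unfold_in => ->.
  case Pt: (P [tuple]) => //; rewrite asboolT//; apply: (PE _ _ Pt).
  by split=> // -[].
pose Q m : pred (N.-tuple 'I_M) := fun t => P (cons_tuple m t).
have -> : #|P|%:R / M%:R ^+ N.+1 = (\sum_(m < M) #|Q m|%:R / M%:R ^+ N) / M%:R :> R.
  rewrite -mulr_suml exprSr invfM mulrA; congr (_ / _ / _).
  rewrite -sum1_card natr_sum big_mkcond /= big_tuple_cons; apply: eq_bigr => m _.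
  by rewrite -sum1_card natr_sum [RHS]big_mkcond.
apply: (integral_ge_cells M (fun x => unif_cube N [set s | E (x :: s)]) (fun m => #|Q m|%:R / M%:R ^+ N)) => //.
- by move=> x; case/andP: (unif_cube_ge0_le1 N [set s | E (x :: s)]).
move=> m x mx; apply: IH => t s Qt [ss ts] /=; apply: (PE _ _ Qt).
split=> [|i]; first by rewrite /= ss.
case: (unliftP ord0 i) => [j ->|->]; last by rewrite tnth0.
by rewrite tnthS /=; exact: ts.
Qed.
End UnifCube.

(** * Domination towards the origin *)

Section Domination.
Variables (R : realType) (d : nat).
Implicit Types x y z : 'I_d -> R.

Definition norm2 x : R := \sum_k x k ^+ 2.
Definition dist2 x y : R := \sum_k (x k - y k) ^+ 2.

Lemma norm2_ge0 x : 0 <= norm2 x.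
Proof. by apply: sumr_ge0 => k _; exact: sqr_ge0. Qed.

Lemma dist2_le_norm2 x y : dist2 x y <= 2 * norm2 x + 2 * norm2 y.
Proof.
rewrite /norm2 !mulr_sumr -big_split /=; apply: ler_sum => k _.
have := sqr_ge0 (x k + y k); lra.
Qed.

(* With q = z - x and e = y - (1 - s) x, the square of
   z - y = q + s x - e expands through 2 q x = z^2 - x^2 - q^2, and AM-GM
   bounds the cross term q e by (s/2) q^2 + (2/s) e^2. *)
Lemma dominated_toward_origin x y z s r :
  0 < s <= 1 -> 8 * s * norm2 x <= r ^+ 2 ->
  16 * dist2 y (fun k => (1 - s) * x k) <= s ^+ 2 * r ^+ 2 ->
  norm2 z <= norm2 x -> dist2 x z <= r ^+ 2 -> dist2 y z <= r ^+ 2.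
Proof.
move=> /andP[s0 s1] sx; set E := dist2 y _ => ye zx xz.
have E0 : 0 <= E by apply: sumr_ge0 => k _; exact: sqr_ge0.
have key : s * dist2 y z <= s * (1 - s / 2) * dist2 x z + (2 + 2 * s) * E +
    (s ^+ 2 * norm2 z + (2 * s ^+ 3 - s ^+ 2) * norm2 x).
  rewrite /E /dist2 /norm2 !mulr_sumr -!big_split /=; apply: ler_sum => k _.
  set a := x k; set b := y k; set c := z k.
  pose e := b - (1 - s) * a; pose q := c - a.
  have -> : b = e + (1 - s) * a by rewrite /e; ring.
  have -> : c = q + a by rewrite /q; ring.
  have h1 : 0 <= (s * q + 2 * e) ^+ 2 by exact: sqr_ge0.
  have h2 : 0 <= s * (s * a + e) ^+ 2 by rewrite mulr_ge0 ?sqr_ge0 ?ltW.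
  rewrite -subr_ge0.
  suff -> : s * (1 - s / 2) * (a - (q + a)) ^+ 2 +
       (2 + 2 * s) * (e + (1 - s) * a - (1 - s) * a) ^+ 2 +
       (s ^+ 2 * (q + a) ^+ 2 + (2 * s ^+ 3 - s ^+ 2) * a ^+ 2) -
       s * (e + (1 - s) * a - (q + a)) ^+ 2 =
    (s * q + 2 * e) ^+ 2 / 2 + s * (s * a + e) ^+ 2.
    by rewrite addr_ge0// divr_ge0.
  by field.
rewrite -(ler_pM2l s0); apply: le_trans key _.
have h1 : s * (1 - s / 2) * dist2 x z <= s * (1 - s / 2) * r ^+ 2.
  by apply: ler_wpM2l => //; rewrite mulr_ge0 ?ltW//; lra.
have h2 : (2 + 2 * s) * E <= 4 * E by apply: ler_wpM2r => //; lra.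
have h3 : s ^+ 2 * norm2 z <= s ^+ 2 * norm2 x by rewrite ler_wpM2l ?sqr_ge0.
have h4 : s ^+ 2 * (8 * s * norm2 x) <= s ^+ 2 * r ^+ 2 by rewrite ler_wpM2l ?sqr_ge0.
(* Shrinking frees s^2 r^2 / 2. Half of it pays for 4E, and half for 2 s^3 |x|^2, which is what
   remains of the last two terms once |z| <= |x| is used. *)
have -> : s * r ^+ 2 = s * (1 - s / 2) * r ^+ 2 + s ^+ 2 * r ^+ 2 / 2 by field.
have e4 : s ^+ 2 * (8 * s * norm2 x) = 8 * (s ^+ 3 * norm2 x) by ring.
have e5 : (2 * s ^+ 3 - s ^+ 2) * norm2 x =
  2 * (s ^+ 3 * norm2 x) - s ^+ 2 * norm2 x by ring.
rewrite e5; lra.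
Qed.

(** AM-GM on the cross term of |(1 - s) x + e|^2 leaves a gain of s^2 |x|^2 against a loss of at
    most 2E <= s^2 r^2 / 8, which is below s^2 |x|^2 / 2. *)
Lemma norm2_lt_toward_origin x y s r :
  0 < s <= 1 -> r ^+ 2 < 4 * norm2 x ->
  16 * dist2 y (fun k => (1 - s) * x k) <= s ^+ 2 * r ^+ 2 ->
  norm2 y < norm2 x.
Proof.
move=> /andP[s0 s1] rx; set E := dist2 y _ => ye.
have E0 : 0 <= E by apply: sumr_ge0 => k _; exact: sqr_ge0.
have key : s * norm2 y <= s * (1 - s) ^+ 2 * (1 + s) * norm2 x + (1 + s) * E.
  rewrite /E /dist2 /norm2 !mulr_sumr -!big_split /=; apply: ler_sum => k _.
  set a := x k; set b := y k; pose e := b - (1 - s) * a.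
  have -> : b = e + (1 - s) * a by rewrite /e; ring.
  rewrite -subr_ge0.
  suff -> : s * (1 - s) ^+ 2 * (1 + s) * a ^+ 2 +
      (1 + s) * (e + (1 - s) * a - (1 - s) * a) ^+ 2 -
      s * (e + (1 - s) * a) ^+ 2 = (s * (1 - s) * a - e) ^+ 2.
    exact: sqr_ge0.
  by ring.
rewrite -(ltr_pM2l s0); apply: le_lt_trans key _.
have h1 : (1 + s) * E <= 2 * E by apply: ler_wpM2r => //; lra.
have h2 : s * (1 - s) ^+ 2 * (1 + s) * norm2 x <= s * (1 - s) * norm2 x.
  apply: ler_wpM2r; first exact: norm2_ge0.
  have -> : s * (1 - s) ^+ 2 * (1 + s) = s * (1 - s) * (1 - s ^+ 2) by ring.
  have s1s : 0 <= s * (1 - s) by rewrite mulr_ge0 ?subr_ge0// ltW.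
  by rewrite -[leRHS]mulr1 ler_wpM2l// lerBlDr lerDl sqr_ge0.
have h3 : s ^+ 2 * r ^+ 2 < s ^+ 2 * (4 * norm2 x) by rewrite ltr_pM2l ?exprn_gt0.
have e1 : s * (1 - s) * norm2 x = s * norm2 x - s ^+ 2 * norm2 x by ring.
have e2 : s ^+ 2 * (4 * norm2 x) = 4 * (s ^+ 2 * norm2 x) by ring.
have h4 : 0 <= s ^+ 2 * norm2 x by rewrite mulr_ge0 ?sqr_ge0 ?norm2_ge0.
rewrite e1 in h2; rewrite e2 in h3; lra.
Qed.
End Domination.

(** * Grid cells whose points dominate those of a given cell *)

Section DominatingCells.
Variables (R : realType) (d M : nat).
Local Notation pt := ('I_d -> R).

Lemma cell_itv (m : nat) (x : R) : (0 < M)%N -> cell R M m x ->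
  m%:R <= M%:R * x < m%:R + 1.
Proof.
rewrite -(@ltr0n R) => M0; rewrite /cell /= in_itv /= -natr1.
by rewrite ler_pdivrMr// ltr_pdivlMr// mulrC.
Qed.

(* The cells met by the points (1 - s) g with s = r^2 M^2 / (32 d m^2) - j / m,
   where m is the largest coordinate of g: consecutive values of j shift that
   coordinate by one cell. *)
Lemma dominating_cells (K : nat) (r : R) (g : {ffun 'I_d -> 'I_M}) :
  (0 < d)%N -> 0 < r -> r ^+ 2 <= d%:R -> 512 * d%:R ^+ 2 <= M%:R * r ^+ 3 ->
  64 * d%:R * K%:R <= M%:R * r ^+ 2 ->
  exists2 W : {set {ffun 'I_d -> 'I_M}}, (K <= #|W|)%N &
    forall g' (x y : pt), g' \in W -> (forall k, cell R M (g k) (x k)) ->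
      (forall k, cell R M (g' k) (y k)) -> r ^+ 2 < 4 * norm2 R d x ->
      norm2 R d y < norm2 R d x /\
      forall z, norm2 R d z <= norm2 R d x -> dist2 R d x z <= r ^+ 2 ->
        dist2 R d y z <= r ^+ 2.
Proof.
move=> d0 r0 rd Mr Kr.
case: d d0 g rd Mr Kr => // d' _ g rd Mr Kr.
set D : R := d'.+1%:R in rd Mr Kr *.
have D1 : 1 <= D by rewrite ler1n.
have M0n : (0 < M)%N by case: (g ord0) => i; case: (M).
have M0 : 0 < M%:R :> R by rewrite ltr0n.
set N := M%:R : R in Mr Kr M0 *.
have r20 : 0 < r ^+ 2 by rewrite exprn_gt0.
have r30 : 0 < r ^+ 3 by rewrite exprn_gt0.
have Nr : 512 * D <= N * r.
  have h1 : N * r * r ^+ 2 <= N * r * D by rewrite ler_wpM2l// mulr_ge0 ?ltW.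
  have h2 : D * (512 * D) <= D * (N * r).
    have -> : D * (512 * D) = 512 * D ^+ 2 by ring.
    apply: le_trans Mr _; have -> : N * r ^+ 3 = N * r * r ^+ 2 by ring.
    by apply: le_trans h1 _; rewrite mulrC.
  by rewrite ler_pM2l// in h2; lra.
have N1 : 1 <= N by rewrite ler1n.
case: (@arg_maxP _ _ _ ord0 predT (fun k => (g k : nat)) isT) => k0 _ gmax.
pose m : R := (g k0 : nat)%:R.
have gm k : (g k : nat)%:R <= m :> R by rewrite ler_nat; exact: gmax.
have m0 : 0 <= m by exact: ler0n.
have mN : m + 1 <= N by rewrite natr1 ler_nat ltn_ord.
have norm2_cell (x : 'I_d'.+1 -> R) : (forall k, cell R M (g k) (x k)) ->
    N ^+ 2 * norm2 R _ x <= D * (m + 1) ^+ 2.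
  move=> gx; rewrite /norm2 mulr_sumr.
  have -> : D * (m + 1) ^+ 2 = \sum_(k < d'.+1) (m + 1) ^+ 2.
    by rewrite sumr_const card_ord mulr_natl.
  apply: ler_sum => k _; rewrite -exprMn.
  have /andP[h1 h2] := cell_itv _ _ M0n (gx k).
  have := gm k; have := ler0n R (g k) => h0 h3.
  by rewrite ler_sqr ?nnegrE; rewrite -/N in h1 h2; lra.
(* If [m] is small, no point of the cell [g] is farther than r/2 from the origin, so the requirement
   is vacuous and [W] may contain every cell. Otherwise 2m < m + 1 forces m = 0, and then N^2 r^2 <
   4D contradicts [Nr]. *)
have [small|big] := leP (16 * D * m ^+ 2) (N ^+ 2 * r ^+ 2).
  exists [set: {ffun 'I_d'.+1 -> 'I_M}]%SET.
    rewrite cardsT card_ffun !card_ord.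
    apply: (@leq_trans M); last by rewrite expnS leq_pmulr// expn_gt0 M0n.
    rewrite -(ler_nat R) -/N.
    have h1 : N * r ^+ 2 <= N * D by rewrite ler_wpM2l// ltW.
    have h2 : D * (64 * K%:R) <= D * N by rewrite mulrCA mulrA [D * N]mulrC; exact: le_trans h1.
    rewrite ler_pM2l in h2; last by lra.
    by have := ler0n R K; lra.
  move=> g' x y _ gx _ rx; exfalso.
  have h1 := norm2_cell _ gx.
  have h2 : N ^+ 2 * r ^+ 2 < N ^+ 2 * (4 * norm2 R _ x).
    by rewrite ltr_pM2l// exprn_gt0.
  have h3 : 16 * D * m ^+ 2 < 4 * D * (m + 1) ^+ 2.
    apply: le_lt_trans small _; apply: lt_le_trans h2 _.
    by rewrite mulrCA -mulrA ler_pM2l.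
  have h4 : (2 * m) ^+ 2 < (m + 1) ^+ 2.
    have D4 : 0 < 4 * D by lra.
    rewrite -(ltr_pM2l D4); apply: le_lt_trans h3.
    by rewrite le_eqVlt; apply/orP; left; apply/eqP; ring.
  have m_lt1 : m < 1.
    rewrite ltr_sqr ?nnegrE in h4; lra.
  have mz : m = 0.
    by move: m_lt1; rewrite /m ltrn1 ltnS leqn0 => /eqP ->.
  have h5 : N ^+ 2 * r ^+ 2 < 4 * D.
    apply: lt_le_trans h2 _; rewrite mulrCA ler_pM2l//.
    by move: h1; rewrite mz add0r expr1n mulr1.
  have Nr1 : 1 <= N * r by lra.
  have h6 : 1 * (N * r) <= N * r * (N * r) by rewrite ler_wpM2r//; lra.
  have h7 : N * r * (N * r) = N ^+ 2 * r ^+ 2 by ring.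
  lra.
have {}m0 : 0 < m.
  rewrite lt_neqAle m0 andbT; apply: contraTneq big => <-.
  by rewrite expr0n mulr0 -leNgt mulr_ge0 ?sqr_ge0.
have m1 : 1 <= m.
  by move: m0; rewrite /m ltr0n => m0; rewrite ler1n.
have Dm0 : 0 < D * m ^+ 2 by rewrite mulr_gt0 ?exprn_gt0//; lra.
(* The largest shrinking factor with 8 s |x|^2 <= r^2 guaranteed, given N^2 |x|^2 <= D (m + 1)^2 <=
   4 D m^2. *)
pose s1 := r ^+ 2 * N ^+ 2 / (32 * (D * m ^+ 2)).
have s1E : s1 * (32 * (D * m ^+ 2)) = r ^+ 2 * N ^+ 2.
  by rewrite /s1 divfK// gt_eqF//; lra.
have s1_half : s1 < 1 / 2.
  rewrite /s1 ltr_pdivrMr; last by lra.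
  by rewrite [_ * N ^+ 2]mulrC; apply: lt_le_trans big _; lra.
pose s (j : 'I_K) := s1 - j%:R / m.
have s_le (j : 'I_K) : s j <= s1.
  by rewrite /s lerBlDr lerDl divr_ge0// ltW.
(* The K shifts use up at most half of [s1], because 64 D K <= N r^2 and m <= N. *)
have s_ge (j : 'I_K) : s1 / 2 <= s j.
  suff : j%:R / m <= s1 / 2 by rewrite /s; lra.
  rewrite ler_pdivrMr//; apply: (@le_trans _ _ K%:R).
    by rewrite ler_nat ltnW.
  have Dm : 0 < 64 * D * m by rewrite !mulr_gt0//; lra.
  rewrite -(ler_pM2r Dm).
  have -> : s1 / 2 * m * (64 * D * m) = s1 * (32 * (D * m ^+ 2)) by field.
  rewrite s1E; have -> : K%:R * (64 * D * m) = 64 * D * K%:R * m by ring.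
  have -> : r ^+ 2 * N ^+ 2 = N * r ^+ 2 * N by ring.
  apply: ler_pM => //; first by rewrite !mulr_ge0//; lra.
  by lra.
have s1_ge : r ^+ 2 / (32 * D) <= s1.
  rewrite ler_pdivrMr; last by lra.
  rewrite -(ler_pM2r (exprn_gt0 2 m0)).
  have -> : s1 * (32 * D) * m ^+ 2 = s1 * (32 * (D * m ^+ 2)) by ring.
  by rewrite s1E ler_pM2l// ler_sqr ?nnegrE; lra.
have r2D : 0 < r ^+ 2 / (32 * D) by rewrite divr_gt0//; lra.
have s1_gt0 : 0 < s1 := lt_le_trans r2D s1_ge.
have s_gt0 j : 0 < s j by have := s_ge j; lra.
have s_le1 j : s j <= 1 by have := s_le j; lra.
pose q (j : 'I_K) (k : 'I_d'.+1) : R := (1 - s j) * (g k : nat)%:R.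
have q_ge0 j k : 0 <= q j k by rewrite mulr_ge0// subr_ge0.
have q_lt j k : (Num.truncn (q j k) < M)%N.
  rewrite truncn_lt_nat//; apply: (@le_lt_trans _ _ ((g k : nat)%:R)).
    by rewrite ler_piMl// lerBlDr lerDl ltW.
  by rewrite ltr_nat.
pose c (j : 'I_K) : {ffun 'I_d'.+1 -> 'I_M} := [ffun k => Ordinal (q_lt j k)].
have c_inj : injective c.
  move=> i j /ffunP/(_ k0); rewrite !ffunE => -[qij].
  have qk0 (l : 'I_K) : q l k0 = (m - s1 * m) + l%:R.
    by rewrite /q /s -/m; field; rewrite gt_eqF.
  have mm : 0 <= m - s1 * m.
    by rewrite -[X in X - _]mul1r -mulrBl mulr_ge0//; lra.
  have := truncn_itv (q_ge0 i k0); have := truncn_itv (q_ge0 j k0).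
  rewrite -qij !qk0 -!natr1 => /andP[h1 h2] /andP[h3 h4].
  have h5 : i%:R < j%:R + 1 :> R by lra.
  have h6 : j%:R < i%:R + 1 :> R by lra.
  move: h5 h6; rewrite !natr1 !ltr_nat !ltnS => h5 h6.
  by apply/val_inj/eqP; rewrite eqn_leq h5 h6.
exists [set c j | j in 'I_K]%SET; first by rewrite card_imset// card_ord.
move=> g' x y /imsetP[j _ ->] gx cy rx.
have s01 : 0 < s j <= 1 by rewrite s_gt0 s_le1.
have close : 16 * dist2 R _ y (fun k => (1 - s j) * x k) <= s j ^+ 2 * r ^+ 2.
  (* In units of the mesh, truncating (1 - s) g and the spread of x and y inside their cells move
     each coordinate by at most 2. *)
  have h1 : N ^+ 2 * dist2 R _ y (fun k => (1 - s j) * x k) <= 4 * D.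
    have -> : 4 * D = \sum_(k < d'.+1) 4 by rewrite sumr_const card_ord mulr_natr.
    rewrite /dist2 mulr_sumr; apply: ler_sum => k _; rewrite -exprMn.
    have /andP[x1 x2] := cell_itv _ _ M0n (gx k).
    have /andP[y1 y2] := cell_itv _ _ M0n (cy k).
    move: y1 y2; rewrite ffunE /= => y1 y2.
    have /andP[q1 q2] := truncn_itv (q_ge0 j k); rewrite -natr1 in q2.
    have sj : 0 <= 1 - s j by rewrite subr_ge0.
    have x3 : q j k <= (1 - s j) * (N * x k) by rewrite ler_wpM2l.
    have x4 : (1 - s j) * (N * x k) <= q j k + (1 - s j).
      have -> : q j k + (1 - s j) = (1 - s j) * ((g k : nat)%:R + 1).
        by rewrite /q; ring.
      by rewrite ler_wpM2l// ltW.
    have sj0 := s_gt0 j.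
    set a := N * (y k - (1 - s j) * x k).
    have aE : a = N * y k - (1 - s j) * (N * x k) by rewrite /a; ring.
    have -> : 4 = a ^+ 2 + (2 - a) * (2 + a) by ring.
    by rewrite lerDl mulr_ge0//; rewrite aE; lra.
  have N20 : 0 < N ^+ 2 by rewrite exprn_gt0.
  (* Scaling by (64 D)^2 brings in s >= r^2 / (64 D). What is left is 64^3 D^4 <= N^2 r^6, the
     square of [Mr], as 512^2 = 64^3. *)
  have D20 : 0 < (64 * D) ^+ 2 by rewrite exprn_gt0//; lra.
  rewrite -(ler_pM2l N20); apply: (@le_trans _ _ (16 * (4 * D))).
    by rewrite mulrCA ler_pM2l.
  rewrite -(ler_pM2l D20).
  have h2 : r ^+ 2 <= 64 * D * s j.
    have D32 : 0 < 32 * D by lra.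
    move: s1_ge; rewrite ler_pdivrMr// => h; have := s_ge j.
    rewrite -(ler_pM2l D32); lra.
  have h3 : (r ^+ 2) ^+ 2 <= (64 * D * s j) ^+ 2.
    by rewrite ler_sqr ?nnegrE// ltW// (lt_le_trans r20 h2).
  have h4 : (512 * D ^+ 2) ^+ 2 <= (N * r ^+ 3) ^+ 2.
    have D2 : 0 <= 512 * D ^+ 2 by have := sqr_ge0 D; lra.
    by rewrite ler_sqr ?nnegrE// (le_trans D2).
  have h5 : N ^+ 2 * r ^+ 2 * (r ^+ 2) ^+ 2 <= N ^+ 2 * r ^+ 2 * (64 * D * s j) ^+ 2.
    by rewrite ler_wpM2l// mulr_ge0 ?ltW.
  have h6 : 64 ^+ 3 * D ^+ 3 * 1 <= 64 ^+ 3 * D ^+ 3 * D.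
    by rewrite ler_wpM2l// mulr_ge0// exprn_ge0//; lra.
  have -> : (64 * D) ^+ 2 * (16 * (4 * D)) = 64 ^+ 3 * D ^+ 3 * 1 by ring.
  have -> : (64 * D) ^+ 2 * (N ^+ 2 * (s j ^+ 2 * r ^+ 2)) =
    N ^+ 2 * r ^+ 2 * (64 * D * s j) ^+ 2 by ring.
  apply: le_trans h6 (le_trans _ h5).
  have -> : 64 ^+ 3 * D ^+ 3 * D = (512 * D ^+ 2) ^+ 2 by ring.
  by apply: le_trans h4 _; rewrite le_eqVlt; apply/orP; left; apply/eqP; ring.
split; first exact: norm2_lt_toward_origin rx close.
move=> z zx xz; apply: dominated_toward_origin close zx xz => //.
have h1 := norm2_cell _ gx.
have N20 : 0 < N ^+ 2 by rewrite exprn_gt0.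
rewrite -(ler_pM2l N20).
have h2 : D * (m + 1) ^+ 2 <= D * (4 * m ^+ 2).
  apply: ler_wpM2l; first by lra.
  have -> : 4 * m ^+ 2 = (2 * m) ^+ 2 by ring.
  by rewrite ler_sqr ?nnegrE; lra.
have h3 : 8 * s j * (N ^+ 2 * norm2 R _ x) <= 8 * s j * (D * (4 * m ^+ 2)).
  apply: ler_wpM2l; first by have := s_gt0 j; lra.
  exact: le_trans h2.
have h4 : s j * (32 * (D * m ^+ 2)) <= s1 * (32 * (D * m ^+ 2)).
  by apply: ler_wpM2r => //; lra.
lra.
Qed.
End DominatingCells.

(** * Counting *)

Section MissedTests.
Variables (d n M K : nat) (W : {ffun 'I_d -> 'I_M} -> {set {ffun 'I_d -> 'I_M}}).
Hypothesis W_big : forall g, (K <= #|W g|)%N.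

Lemma coord_subproof (i : 'I_n) (k : 'I_d) : (i * d + k < n * d)%N.
Proof.
by rewrite -ltn_subRL -mulnBl; apply: leq_trans (ltn_ord k) _; rewrite leq_pmull// subn_gt0.
Qed.

Definition coord (i : 'I_n) (k : 'I_d) : 'I_(n * d) := Ordinal (coord_subproof i k).

Definition cells_of (t : (n * d).-tuple 'I_M) : {ffun 'I_n -> {ffun 'I_d -> 'I_M}} :=
  [ffun i => [ffun k => tnth t (coord i k)]].

Lemma cells_of_inj : injective cells_of.
Proof.
move=> t u /ffunP tu; apply: eq_from_tnth => l.
have d0 : (0 < d)%N by case: l; case: (d) => //; rewrite muln0.
have ln : (l %/ d < n)%N by rewrite ltn_divLR.
have ld : (l %% d < d)%N by rewrite ltn_mod.
have -> : l = coord (Ordinal ln) (Ordinal ld).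
  by apply: val_inj; rewrite /= -divn_eq.
by have /ffunP/(_ (Ordinal ld)) := tu (Ordinal ln); rewrite !ffunE.
Qed.

(** Asked of every cell [g], occupied or not, so that the union bound needs no conditioning on the
    position of a vertex. *)
Definition hits (t : (n * d).-tuple 'I_M) : bool :=
  [forall g, exists i, cells_of t i \in W g].

(** Union bound over the M^d cells [g]: if [W g] is missed, each of the n vertices has at most M^d -
    K cells to choose from. *)
Lemma card_not_hits : (#|predC hits| <= M ^ d * (M ^ d - K) ^ n)%N.
Proof.
rewrite -(card_imset _ cells_of_inj).
pose miss g := [set f : {ffun 'I_n -> {ffun 'I_d -> 'I_M}} |
  f \in ffun_on (mem (~: W g)%SET)]%SET.
apply: (@leq_trans #|(\bigcup_g miss g)%SET|).
  apply: subset_leq_card; apply/fintype.subsetP => _ /imsetP[t + ->].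
  rewrite inE /= negb_forall => /existsP[g]; rewrite negb_exists => /forallP gt.
  apply/finset.bigcupP; exists g => //; rewrite inE; apply/ffun_onP => i.
  by rewrite inE.
apply: (@leq_trans (\sum_g #|miss g|)%N).
  elim/big_ind2 : _ => [|m A m' B Am Bm'|//]; first by rewrite cards0.
  by rewrite (leq_trans (leq_card_setU _ _))// leq_add.
have -> : (M ^ d * (M ^ d - K) ^ n = \sum_(g : {ffun 'I_d -> 'I_M}) (M ^ d - K) ^ n)%N.
  by rewrite sum_nat_const card_ffun !card_ord.
apply: leq_sum => g _; rewrite cardsE card_ffun_on card_ord.
have : (#|(~: W g)%SET| <= M ^ d - K)%N.
  by rewrite cardsCs finset.setCK card_ffun !card_ord leq_sub2l.
by case: n => // n' h; rewrite leq_exp2r.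
Qed.
End MissedTests.

(** * Random geometric graphs *)

Section Rgg.
Variables (R : realType) (d n : nat).

Definition pos (s : seq R) (i : 'I_n) (k : 'I_d) : R := nth 0 s (i * d + k)%N.

Lemma rgg_pmove (r : R) (s : seq R) (i j : 'I_n) : 0 <= r ->
  pmove (@rgg_adj R d n r s) i j = (dist2 R d (pos s i) (pos s j) <= r ^+ 2).
Proof.
move=> r0.
have -> : dist2 R d (pos s i) (pos s j) <= r ^+ 2 =
    (euclid_dist (@rgg_point R d n s i) (@rgg_point R d n s j) <= r).
  rewrite -[in RHS](ger0_norm r0) -sqrtr_sqr ler_sqrt ?sqr_ge0//.
  by congr (_ <= _); apply: eq_bigr => k _; rewrite !mxE.
rewrite /pmove /rgg_adj eq_sym; case: eqVneq => //= ->.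
rewrite /euclid_dist big1 ?sqrtr0 ?r0// => k _.
by rewrite subrr expr0n.
Qed.

Lemma rgg_adj_sym (r : R) (s : seq R) : symmetric (@rgg_adj R d n r s).
Proof.
move=> i j; rewrite /rgg_adj eq_sym; congr (_ && (Num.sqrt _ <= _)).
by apply: eq_bigr => k _; rewrite -sqrrN opprB.
Qed.

Hypothesis n0 : (0 < n)%N.

Lemma in_cells_pos M (t : (n * d).-tuple 'I_M) (s : seq R) (i : 'I_n) (k : 'I_d) :
  in_cells R M (n * d) t s -> cell R M (cells_of d n M t i k) (pos s i k).
Proof. by case=> _ /(_ (coord d n i k)); rewrite !ffunE. Qed.

(** Every point configuration lying in a box [t] with [hits t] is dismantlable by distance to the
    origin, so the failure probability is at most the proportion of tuples that do not hit. *)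
Lemma rgg_prob_ge_cells (M K : nat) (r : R) :
  (0 < d)%N -> (0 < M)%N -> 0 < r -> r ^+ 2 <= d%:R ->
  512 * d%:R ^+ 2 <= M%:R * r ^+ 3 -> 64 * d%:R * K%:R <= M%:R * r ^+ 2 ->
  ((1 - M%:R ^+ d * (1 - K%:R / M%:R ^+ d) ^+ n)%:E <=
    @rgg_prob R d n r (fun adj => cop_number_is_one adj))%E.
Proof.
move=> d0 M0 r0 rd Mr Kr.
have [W W_big W_dom] : exists2 W : {ffun 'I_d -> 'I_M} -> {set {ffun 'I_d -> 'I_M}},
    forall g, (K <= #|W g|)%N & forall g g' (x y : 'I_d -> R), g' \in W g ->
      (forall k, cell R M (g k) (x k)) -> (forall k, cell R M (g' k) (y k)) ->
      r ^+ 2 < 4 * norm2 R d x -> norm2 R d y < norm2 R d x /\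
      forall z, norm2 R d z <= norm2 R d x -> dist2 R d x z <= r ^+ 2 ->
        dist2 R d y z <= r ^+ 2.
  pose W g := cid2 (dominating_cells R d M K r g d0 r0 rd Mr Kr).
  exists (fun g => s2val (W g)) => g; first exact: (s2valP (W g)).
  exact: (s2valP' (W g)).
apply: le_trans (unif_cube_ge_cells R M (n * d) _ (hits d n M W) M0 _); last first.
  move=> t s /forallP tW ts /=.
  (* The threshold is (r/2)^2: two points within r/2 of the origin are adjacent. *)
  apply: (cop_win_of_domination _ _ R (fun i => norm2 R d (pos s i)) (r ^+ 2 / 4)).
  - by rewrite card_ord.
  - exact: rgg_adj_sym.
  - move=> i j /= ir jr; rewrite (rgg_pmove _ _ _ _ (ltW r0)).
    by have := dist2_le_norm2 R d (pos s i) (pos s j); lra.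
  move=> i /= ri; have /existsP[j jW] := tW (cells_of d n M t i).
  have [|||ji dom] := W_dom _ _ (pos s i) (pos s j) jW.
  - by move=> k; exact: in_cells_pos.
  - by move=> k; exact: in_cells_pos.
  - by lra.
  exists j => // l li; rewrite !(rgg_pmove _ _ _ _ (ltW r0)).
  exact: dom.
rewrite lee_fin; have M0' : 0 < M%:R :> R by rewrite ltr0n.
have Md0 : 0 < M%:R ^+ d :> R by rewrite exprn_gt0.
rewrite ler_pdivlMr ?exprn_gt0// mulrBl mul1r lerBlDr.
have KM (g : {ffun 'I_d -> 'I_M}) : (K <= M ^ d)%N.
  by apply: leq_trans (W_big g) _; rewrite (leq_trans (max_card _))// card_ffun !card_ord.
have {}KM : (K <= M ^ d)%N by apply: KM; exact: [ffun=> Ordinal M0].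
have -> : M%:R ^+ d * (1 - K%:R / M%:R ^+ d) ^+ n * M%:R ^+ (n * d) =
    (M ^ d * (M ^ d - K) ^ n)%:R :> R.
  rewrite natrM !natrX natrB// natrX [(n * d)%N]mulnC exprM -mulrA -exprMn.
  by rewrite mulrBl mul1r divfK// gt_eqF.
rewrite -natrX -natrD ler_nat.
have := cardC (hits d n M W); rewrite card_tuple card_ord => <-.
by rewrite leq_add2l; exact: card_not_hits.
Qed.

(** Beyond the diameter of the cube the graph is complete. The grid with one cell and a constant
    [phi] put every vertex in the core. *)
Lemma rgg_prob_complete (r : R) : 0 < r -> d%:R < r ^+ 2 ->
  @rgg_prob R d n r (fun adj => cop_number_is_one adj) = 1%E.
Proof.
move=> r0 dr; apply/eqP; rewrite eq_le; apply/andP; split.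
  by case/andP: (unif_cube_ge0_le1 R (n * d)
    [set s | cop_number_is_one (@rgg_adj R d n r s)]).
have -> : 1%E = (#|(predT : pred ((n * d).-tuple 'I_1))|%:R / 1 ^+ (n * d) : R)%:E.
  by rewrite card_tuple card_ord exp1n expr1n divr1.
apply: (unif_cube_ge_cells R 1) => // t s _ ts /=.
apply: (cop_win_of_domination _ _ R (fun=> 0) 0); rewrite ?card_ord//.
- exact: rgg_adj_sym.
- move=> i j _ _; rewrite (rgg_pmove _ _ _ _ (ltW r0)); apply: le_trans (ltW dr).
  rewrite -[leRHS]mulr1n -[d in leRHS]card_ord -sumr_const.
  apply: ler_sum => k _.
  have /cell_unit/andP[i0 i1] := in_cells_pos _ _ _ i k ts.
  have /cell_unit/andP[j0 j1] := in_cells_pos _ _ _ j k ts.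
  set a := pos s i k in i0 i1 *; set b := pos s j k in j0 j1 *.
  have -> : 1 = (a - b) ^+ 2 + (1 - (a - b)) * (1 + (a - b)) by ring.
  by rewrite lerDl mulr_ge0//; lra.
- by move=> i; rewrite ltxx.
Qed.
End Rgg.

(** * Choice of the grid and passage to the limit *)

Lemma one_sub_expn_le_exp (R : realType) (p : R) (n : nat) :
  p <= 1 -> (1 - p) ^+ n <= expR (- (p * n%:R)).
Proof.
move=> p1; rewrite -mulNr expRM_natr.
by apply: lerXn2r; rewrite ?nnegrE ?subr_ge0 ?expR_ge0// expR_ge1Dx.
Qed.

(** In dimension d + 1, with M about 512 D^2 / r^3 and K about M r^2 / (64 D). [B] bounds M r^3, and
    [kappa] is chosen so that K / M^(d+1) >= kappa r^(3d+2). The failure bound is then the product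
    of M^(d+1) <= B^(d+1) n^2 and n^-3. *)
Lemma rgg_prob_lower_bound (R : realType) (d n : nat) (r : R)
    (B := 1024 * d.+1%:R ^+ 2 : R) (kappa := (128 * d.+1%:R * B ^+ d)^-1) :
  (1 < n)%N -> 0 < r -> r ^+ 2 <= d.+1%:R ->
  3 / kappa * ln n%:R / n%:R < r ^+ (3 * d + 2) ->
  ((1 - B ^+ d.+1 / n%:R)%:E <=
    @rgg_prob R d.+1 n r (fun adj => cop_number_is_one adj))%E.
Proof.
move=> n1 r0 rd rn.
set D : R := d.+1%:R in B kappa rd rn *.
have D1 : 1 <= D by rewrite ler1n.
have n0 : 0 < n%:R :> R by rewrite ltr0n ltnW.
have r_le : r <= D by rewrite -ler_sqr ?nnegrE; nra.
have r30 : 0 < r ^+ 3 by rewrite exprn_gt0.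
have r20 : 0 < r ^+ 2 by rewrite exprn_gt0.
have r3_le : r ^+ 3 <= D ^+ 2.
  by rewrite exprSr expr2 ler_pM// ltW.
pose X := 512 * D ^+ 2 / r ^+ 3; pose M := (Num.truncn X).+1.
have D2 : 1 <= D ^+ 2 by rewrite exprn_ege1.
have X0 : 0 <= X by apply: divr_ge0; [lra|exact: ltW].
have Mr : 512 * D ^+ 2 <= M%:R * r ^+ 3.
  by rewrite -ler_pdivrMr// ltW// truncnS_gt.
have M_le : M%:R * r ^+ 3 <= B.
  have /andP[+ _] := truncn_itv X0; rewrite -(ler_pM2r r30) divfK ?gt_eqF// => h.
  by rewrite /M -natr1 mulrDl mul1r /B; lra.
have M0 : 0 < M%:R :> R by rewrite ltr0n.
have Mr3 : 0 <= M%:R * r ^+ 3 by apply: mulr_ge0; exact: ltW.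
have B0 : 0 < B by rewrite /B; lra.
have kappa0 : 0 < kappa.
  by rewrite invr_gt0 !mulr_gt0// ?exprn_gt0//; lra.
pose Y := M%:R * r ^+ 2 / (64 * D); pose K := Num.truncn Y.
have Y1 : 1 <= Y.
  rewrite ler_pdivlMr; last by lra.
  rewrite mul1r -(ler_pM2r r0).
  have -> : M%:R * r ^+ 2 * r = M%:R * r ^+ 3 by ring.
  apply: le_trans Mr; apply: (@le_trans _ _ (64 * D * D)); last by rewrite -mulrA -expr2; lra.
  by rewrite ler_pM2l//; lra.
have Y0 : 0 <= Y by lra.
have Kr : 64 * D * K%:R <= M%:R * r ^+ 2.
  rewrite mulrC -ler_pdivlMr; last by lra.
  by rewrite /K truncn_le.
(* As Y >= 1, truncation loses at most a factor 2, whence 128 = 2 * 64. *)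
have K_ge : M%:R * r ^+ 2 <= 128 * D * K%:R.
  have K1 : 1 <= K%:R :> R by rewrite ler1n truncn_gt0.
  have := truncnS_gt Y; rewrite -/K -natr1 ltr_pdivrMr; last by lra.
  move/ltW => h; apply: le_trans h _.
  have -> : 128 * D * K%:R = (2 * K%:R) * (64 * D) by ring.
  by rewrite ler_pM2r; lra.
apply: le_trans (rgg_prob_ge_cells R d.+1 n (ltnW n1) M K r isT isT r0 rd Mr Kr).
rewrite lee_fin lerD2l lerN2.
have Md0 : 0 < M%:R ^+ d.+1 :> R by rewrite exprn_gt0.
set p := K%:R / M%:R ^+ d.+1.
have p1 : p <= 1.
  rewrite ler_pdivrMr// mul1r; apply: (@le_trans _ _ M%:R); last first.
    by rewrite ler_eXnr// ler1n.
  have h : M%:R * r ^+ 2 <= M%:R * D by rewrite ler_pM2l.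
  have h' := le_trans Kr h.
  have h2 : D * (64 * K%:R) <= D * M%:R by rewrite mulrCA mulrA [D * M%:R]mulrC.
  have K0 : 0 <= K%:R :> R by [].
  rewrite ler_pM2l in h2; lra.
have p_ge : kappa * r ^+ (3 * d + 2) <= p.
  have C0 : 0 < 128 * D * B ^+ d by rewrite -invr_gt0.
  have kC : kappa * (128 * D * B ^+ d) = 1 by rewrite /kappa mulVf ?gt_eqF.
  rewrite ler_pdivlMr// -(ler_pM2l C0).
  have -> : 128 * D * B ^+ d * (kappa * r ^+ (3 * d + 2) * M%:R ^+ d.+1) =
      kappa * (128 * D * B ^+ d) * (M%:R ^+ d.+1 * r ^+ (3 * d + 2)) by ring.
  rewrite kC mul1r.
  have -> : M%:R ^+ d.+1 * r ^+ (3 * d + 2) = (M%:R * r ^+ 2) * (M%:R * r ^+ 3) ^+ d.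
    rewrite exprD [r ^+ (3 * d)]exprM [(M%:R * r ^+ 3) ^+ d]exprMn [M%:R ^+ d.+1]exprS.
    move: (M%:R : R) => w; move: (w ^+ d) ((r ^+ 3) ^+ d) => u v.
    by ring.
  have -> : 128 * D * B ^+ d * K%:R = 128 * D * K%:R * B ^+ d by ring.
  apply: ler_pM => //; first by apply: mulr_ge0; exact: ltW.
    exact: exprn_ge0.
  by apply: lerXn2r; rewrite ?nnegrE// ltW.
have pn : 3 * ln n%:R <= p * n%:R.
  apply: (@le_trans _ _ (kappa * r ^+ (3 * d + 2) * n%:R)); last by rewrite ler_pM2r.
  have -> : 3 * ln n%:R = kappa * (3 / kappa * ln n%:R / n%:R) * n%:R :> R.
    by field; rewrite !gt_eqF.
  by rewrite ler_pM2r// ler_pM2l// ltW.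
have q_le : (1 - p) ^+ n <= n%:R ^- 3.
  apply: le_trans (one_sub_expn_le_exp _ _ _ p1) _.
  apply: (@le_trans _ _ (expR (- (3 * ln n%:R)))); first by rewrite ler_expR lerN2.
  by rewrite expRN expRM_natl lnK ?posrE.
have ln_ge : 1 / 2 <= ln n%:R :> R.
  have h : ln 2^-1 <= 2^-1 - 1 :> R.
    by have := @le_ln1Dx R (2^-1 - 1); rewrite [1 + _]addrC subrK; apply; lra.
  rewrite lnV ?posrE// in h; apply: (@le_trans _ _ (ln 2)); first by lra.
  by rewrite ler_ln ?posrE// ler_nat.
have c_ge : 2 <= 3 / kappa.
  have B1 : 1 <= B by rewrite /B; lra.
  have Bd : 1 <= B ^+ d by rewrite exprn_ege1.
  rewrite /kappa invrK; have : 128 * D * 1 <= 128 * D * B ^+ d by rewrite ler_pM2l; lra.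
  lra.
(* The threshold also keeps r from being too small: 3 / kappa >= 2 and ln n >= 1/2. *)
have un : 1 <= r ^+ (3 * d + 2) * n%:R.
  rewrite -ler_pdivrMr//; apply: le_trans (ltW rn); rewrite ler_pM2r ?invr_gt0//.
  by have := ler_pM _ _ c_ge ln_ge; lra.
(* For r <= 1 compare exponents: 3d + 3 <= 2 (3d + 2). *)
have rn2 : 1 <= r ^+ (3 * d.+1) * n%:R ^+ 2.
  have [r1|/ltW r1] := leP r 1; last first.
    by rewrite -[leLHS]mulr1 ler_pM// exprn_ege1// ler1n ltnW.
  apply: (@le_trans _ _ ((r ^+ (3 * d + 2) * n%:R) ^+ 2)); first by rewrite exprn_ege1.
  rewrite exprMn -exprM ler_wpM2r ?sqr_ge0//; apply: ler_wiXn2l; rewrite ?(ltW r0)//.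
  by rewrite mulnS mulnDl addnC; apply: leq_add => //; exact: leq_pmulr.
have M_pow : M%:R ^+ d.+1 <= B ^+ d.+1 * n%:R ^+ 2.
  apply: (@le_trans _ _ (M%:R ^+ d.+1 * (r ^+ (3 * d.+1) * n%:R ^+ 2))).
    by rewrite ler_peMr// ltW.
  rewrite mulrA exprM -exprMn; apply: ler_wpM2r; first exact: sqr_ge0.
  by apply: lerXn2r; rewrite ?nnegrE// ltW.
apply: (@le_trans _ _ (B ^+ d.+1 * n%:R ^+ 2 * n%:R ^- 3)).
  by apply: ler_pM => //; apply: exprn_ge0; rewrite ?subr_ge0.
by rewrite le_eqVlt; apply/orP; left; apply/eqP; field; rewrite gt_eqF.
Qed.

Theorem theorem2p2 (R : realType) (d : nat) :
  (1 < d)%N ->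
  exists c : R, 0 < c /\
    forall r : nat -> R,
      (forall n, 0 < r n) ->
      (\forall n \near \oo, c * ln (n%:R : R) / n%:R < r n ^+ (3 * d - 1)) ->
      (fun n : nat => @rgg_prob R d n (r n) (fun adj => cop_number_is_one adj))
        @ \oo --> 1%E.
Proof.
case: d => // d _.
pose B : R := 1024 * d.+1%:R ^+ 2.
have D0 : 0 < d.+1%:R :> R by rewrite ltr0n.
have B0 : 0 < B.
  by rewrite /B; have := exprn_gt0 2 D0; move: (_ ^+ 2) => D2; lra.
have C0 : 0 < 128 * d.+1%:R * B ^+ d.
  by apply: mulr_gt0; [lra|exact: exprn_gt0].
exists (3 / (128 * d.+1%:R * B ^+ d)^-1); split.
  by rewrite invrK; lra.
move=> r r0 rn.
have e3 : (3 * d.+1 - 1 = 3 * d + 2)%N by rewrite mulnS addnC -addnBA.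
rewrite e3 in rn.
(* [harmonic n] is 1/(n + 1); the factor 2 absorbs the shift, since 1/n <= 2/(n + 1). *)
apply: (@squeeze_cvge _ _ _ _ (fun n => (1 - 2 * B ^+ d.+1 * harmonic n)%:E) _ (cst 1%E)); last 2 first.
- apply: cvg_EFin; first by apply: nearW.
  rewrite -[X in _ --> X]subr0 -[X in _ --> _ - X](mulr0 (2 * B ^+ d.+1)).
  apply: cvgB; first exact: cvg_cst.
  by apply: cvgMl_tmp; exact: cvg_harmonic.
- exact: cvg_cst.
near=> n.
have n1 : (1 < n)%N by near: n; exact: nbhs_infty_gt.
have n0 : (0 < n)%N by exact: ltnW.
have /andP[_ ->] := unif_cube_ge0_le1 R (n * d.+1)
  [set s | cop_number_is_one (@rgg_adj R d.+1 n (r n) s)].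
rewrite andbT.
have Bd0 : 0 <= B ^+ d.+1 by rewrite exprn_ge0// ltW.
(* The quantitative bound needs r^2 <= d + 1; for larger r the graph is complete. *)
have [dr|rd] := ltP d.+1%:R (r n ^+ 2).
  rewrite (rgg_prob_complete R d.+1 n n0 _ (r0 n) dr) lee_fin lerBlDr lerDl.
  by apply: mulr_ge0; [exact: mulr_ge0|exact: harmonic_ge0].
apply: le_trans (rgg_prob_lower_bound R d n (r n) n1 (r0 n) rd _); last first.
  by near: n; exact: rn.
rewrite lee_fin lerD2l lerN2 -/B [2 * _]mulrC -mulrA ler_wpM2l// /harmonic.
rewrite ler_pdivlMr ?ltr0n// mulrC ler_pdivrMr ?ltr0n//.
by rewrite mulr_natl mulr2n -natrD ler_nat -add1n leq_add2r.
Unshelve. all: by end_near.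
Qed.
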